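(* For any non-empty $\Delta$-complex $X$, the cochain algebra $C^*(X;R)$, where $R=\mathbb Z$ or $\mathbb F_p$ ($p$ a prime), is a binomial cup-one dga over $R$.
   Context: A $\Delta$-complex is the geometric realization of a $\Delta$-set (sets $X_n$, $n\ge0$, with face maps satisfying $d_id_j=d_{j-1}d_i$ for $i<j$). $C=C^*(X;R)$ is the simplicial cochain dga, with the usual coboundary and cup product (for 1-cochains, $(u\cup v)(s)=u(e_1)v(e_2)$ where $e_1,e_2$ are the front and back faces of the 2-simplex $s$). The additional structure is: $\cup_1\colon C^1\otimes_RC^1\to C^1$, $(u\cup_1v)(e)=u(e)v(e)$ for 1-simplices $e$; $\circ\colon C^2\otimes_RC^2\to C^2$, $(v\circ w)(s)=v(s)w(s)$ for 2-simplices $s$, restricted to $D^2(C)$; Steenrod's $\cup_1$-product $D^2(C)\otimes_R C^1\to C^2$, which satisfies the Hirsch identity below; and binomial maps $\zeta_n(f)(e)=f(e)(f(e)-1)\cdots(f(e)-n+1)/n!$ on 1-cochains ($n\ge1$ if $R=\mathbb Z$, $1\le n\le p-1$ if $R=\mathbb F_p$). Binomial cup-one dga. A dga over $R$ is a graded $R$-algebra $A=\bigoplus_{i\ge0}A^i$ (product $\cup$) with a degree-one map $d$, $d^2=0$, satisfying the graded Leibniz rule. $D^2(A)\subset A^2$ is the $R$-span of all $a\cup b$, $a,b\in A^1$. A cup-one dga is a dga with $R$-linear maps $\cup_1\colon A^1\otimes_R A^1\to A^1$, $\cup_1\colon D^2(A)\otimes_R A^1\to A^2$, $\circ\colon D^2(A)\otimes_R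 D^2(A)\to D^2(A)$ such that: (i) $R\oplus A^1$, with multiplication given by that of $R$, scalar multiplication, and $\cup_1$ on $A^1$, is a commutative $R$-algebra with identity $1\in R$; (ii) (Hirsch identity) $(a\cup b)\cup_1 c=a\cup(b\cup_1 c)+(a\cup_1 c)\cup b$ for $a,b,c\in A^1$; (iii) $(u\cup v)\circ(w\cup z)=(u\cup_1 w)\cup(v\cup_1 z)$ for $u,v,w,z\in A^1$; (iv) $a\cup_1 dc=a\cup c-c\cup a$ for $a\in A^1$, $c\in A^0$; (v) $d(a\cup_1 b)=-a\cup b-b\cup a+da\cup_1 b+db\cup_1 a-da\circ db$ for all $a,b\in A^1$ with $da,db\in D^2(A)$. An $R$-binomial algebra is: for $R=\mathbb{Z}$, a commutative ring, torsion-free as abelian group, in which $\binom{a}{n}$ lies in the ring for all $a$ and $n>0$; for $R=\mathbb{F}_p$, a commutative $\mathbb{F}_p$-algebra with $a(a-1)\cdots(a-p+1)=0$ for all $a$. A binomial cup-one dga is a cup-one dga such that $A^0$ (under $\cup$) and $R\oplus A^1$ (under $\cup_1$) are $R$-binomial algebras. *)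

(* Defs.v *)
From HB Require Import structures.
From mathcomp Require Export all_boot all_algebra.
From mathcomp Require Export boolp functions.

Set Implicit Arguments.
Unset Strict Implicit.
Unset Printing Implicit Defensive.

Export GRing.Theory.
#[global] Open Scope ring_scope.

Definition bilinear_map (R : comNzRingType) (U V W : lmodType R)
    (f : U -> V -> W) : Prop :=
  (forall v, linear (fun u => f u v)) /\ (forall u, linear (f u)).

(* Only the operations; the laws are in [is_dga]. *)
Record dga_data (R : comNzRingType) := DgaData {
  dga_deg :> nat -> lmodType R;
  cup : forall i j, dga_deg i -> dga_deg j -> dga_deg (i + j)%N;
  cup_one : dga_deg 0%N;
  dif : forall i, dga_deg i -> dga_deg i.+1
}.

Arguments cup {R d i j}.
Arguments cup_one {R} d.
Arguments dif {R d i}.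

Definition degcast (R : comNzRingType) (A : nat -> lmodType R) (i j : nat)
    (e : i = j) (a : A i) : A j :=
  ecast k (A k) e a.

(* [0 + i] and [i.+1 + j] are convertible to [i] and [(i + j).+1]; the other
   degree identities need a cast. *)
Record is_dga (R : comNzRingType) (A : dga_data R) : Prop := IsDga {
  cup_bilinear : forall i j, bilinear_map (@cup R A i j);
  cup_assoc : forall i j k (a : A i) (b : A j) (c : A k),
    degcast (addnA i j k) (cup a (cup b c)) = cup (cup a b) c;
  cup_1l : forall i (a : A i), (cup (cup_one A) a : A i) = a;
  cup_1r : forall i (a : A i), degcast (addn0 i) (cup a (cup_one A)) = a;
  dif_linear : forall i, linear (@dif R A i);
  dif_dif : forall i (a : A i), dif (dif a) = 0;
  dif_cup : forall i j (a : A i) (b : A j),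
    dif (cup a b) =
      (cup (dif a) b : A (i + j).+1%N)
      + (-1) ^+ i *: degcast (addnS i j) (cup a (dif b))
}.

Definition in_D2 (R : comNzRingType) (A : dga_data R) (w : A 2%N) : Prop :=
  exists (n : nat) (r : 'I_n -> R) (a b : 'I_n -> A 1%N),
    w = \sum_(i < n) r i *: (cup (a i) (b i) : A 2%N).

Definition D2_pred (R : comNzRingType) (A : dga_data R) : {pred A 2%N} :=
  fun w => `[< in_D2 w >].

Arguments D2_pred {R} A.

Lemma D2_submod (R : comNzRingType) (A : dga_data R) :
  submod_closed (D2_pred A).
Proof.
split=> [|k x y /asboolP[m [r [a [b ->]]]] /asboolP[n [s [c [e ->]]]]];
    apply/asboolP.
  by exists 0%N, (fun=> 0), (fun=> 0), (fun=> 0); rewrite big_ord0.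
exists (m + n)%N,
  (fun i => match fintype.split i with inl j => k * r j | inr j => s j end),
  (fun i => match fintype.split i with inl j => a j | inr j => c j end),
  (fun i => match fintype.split i with inl j => b j | inr j => e j end).
rewrite big_split_ord /= scaler_sumr; congr (_ + _); apply: eq_bigr => i _.
  by rewrite (unsplitK (inl i : 'I_m + 'I_n)) scalerA.
by rewrite (unsplitK (inr i : 'I_m + 'I_n)).
Qed.

HB.instance Definition _ (R : comNzRingType) (A : dga_data R) :=
  GRing.isSubmodClosed.Build R (A 2%N) (D2_pred A) (D2_submod A).

Record D2 (R : comNzRingType) (A : dga_data R) := MkD2 {
  D2val :> A 2%N;
  D2valP : D2val \in D2_pred A
}.

HB.instance Definition _ (R : comNzRingType) (A : dga_data R) :=
  [isSub for @D2val R A].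
HB.instance Definition _ (R : comNzRingType) (A : dga_data R) :=
  [Choice of D2 A by <:].
HB.instance Definition _ (R : comNzRingType) (A : dga_data R) :=
  [SubChoice_isSubLmodule of D2 A by <:].

Lemma cup_in_D2 (R : comNzRingType) (A : dga_data R) (a b : A 1%N) :
  (cup a b : A 2%N) \in D2_pred A.
Proof.
apply/asboolP; exists 1%N, (fun=> 1), (fun=> a), (fun=> b).
by rewrite big_ord1 scale1r.
Qed.

Definition D2cup (R : comNzRingType) (A : dga_data R) (a b : A 1%N) : D2 A :=
  MkD2 (cup_in_D2 a b).

Record is_comm_ring (V : zmodType) (mul : V -> V -> V) (one : V) : Prop :=
  IsCommRing {
  crmulA : associative mul;
  crmulC : commutative mul;
  crmul1 : left_id one mul;
  crmulDl : left_distributive mul +%R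
}.

Record is_comm_algebra (R : comNzRingType) (V : lmodType R)
    (mul : V -> V -> V) (one : V) : Prop := IsCommAlgebra {
  ca_ring : is_comm_ring mul one;
  ca_scale : forall (r : R) (x y : V), mul (r *: x) y = r *: mul x y
}.

(* a (a - 1) ... (a - n + 1) *)
Definition falling (V : zmodType) (mul : V -> V -> V) (one a : V) (n : nat) : V :=
  \big[mul/one]_(i < n) (a - one *+ i).

(* In a torsion-free ring V, the element a (a - 1) ... (a - n + 1) / n! of
   V (x) Q lies in V iff a (a - 1) ... (a - n + 1) is n! times some b in V. *)
Record Z_binomial (V : lmodType int) (mul : V -> V -> V) (one : V) : Prop :=
  ZBinomial {
  zb_ring : is_comm_ring mul one;
  zb_torsion_free : forall (n : nat) (v : V), (0 < n)%N -> v *+ n = 0 -> v = 0;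
  zb_binomial : forall (a : V) (n : nat), (0 < n)%N ->
    exists b : V, b *+ n`! = falling mul one a n
}.

Record Fp_binomial (p : nat) (V : lmodType 'F_p) (mul : V -> V -> V) (one : V) :
  Prop := FpBinomial {
  fpb_algebra : is_comm_algebra mul one;
  fpb_falling : forall a : V, falling mul one a p = 0
}.

Record cup_one_data (R : comNzRingType) := CupOneData {
  cod_dga :> dga_data R;
  cup1 : cod_dga 1%N -> cod_dga 1%N -> cod_dga 1%N;
  cup1D : D2 cod_dga -> cod_dga 1%N -> cod_dga 2%N;
  (* that [circ] takes values in D^2 is one of the laws below *)
  circ : D2 cod_dga -> D2 cod_dga -> cod_dga 2%N
}.

Arguments cup1 {R c}.
Arguments cup1D {R c}.
Arguments circ {R c}.

(* The product of R (+) A^1, modelled on [R^o * A 1]. *)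
Definition RA1_mul (R : comNzRingType) (A : cup_one_data R)
    (x y : (R^o * A 1%N)%type) : (R^o * A 1%N)%type :=
  (x.1 * y.1, x.1 *: y.2 + y.1 *: x.2 + cup1 x.2 y.2).

Definition RA1_one (R : comNzRingType) (A : cup_one_data R) : (R^o * A 1%N)%type :=
  (1, 0).

Record is_cup_one_dga (R : comNzRingType) (A : cup_one_data R) : Prop :=
  IsCupOneDga {
  cod_is_dga : is_dga A;
  cup1_bilinear : bilinear_map (@cup1 R A);
  cup1D_bilinear : bilinear_map (@cup1D R A);
  circ_in_D2 : forall v w : D2 A, circ v w \in D2_pred A;
  circ_bilinear : bilinear_map (@circ R A);
  RA1_algebra : is_comm_algebra (@RA1_mul R A) (RA1_one A);
  hirsch : forall a b c : A 1%N,
    cup1D (D2cup a b) c = cup a (cup1 b c) + cup (cup1 a c) b;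
  circ_cup : forall u v w z : A 1%N,
    circ (D2cup u v) (D2cup w z) = cup (cup1 u w) (cup1 v z);
  cup1_dif : forall (a : A 1%N) (c : A 0%N),
    cup1 a (dif c) = (cup a c : A 1%N) - (cup c a : A 1%N);
  dif_cup1 : forall (a b : A 1%N)
      (ha : dif a \in D2_pred A) (hb : dif b \in D2_pred A),
    dif (cup1 a b) =
      - (cup a b : A 2%N) - (cup b a : A 2%N) + cup1D (MkD2 ha) b
      + cup1D (MkD2 hb) a - circ (MkD2 ha) (MkD2 hb)
}.

Definition is_binomial_cup_one_dga (R : comNzRingType)
    (binomial : forall V : lmodType R, (V -> V -> V) -> V -> Prop)
    (A : cup_one_data R) : Prop :=
  [/\ is_cup_one_dga A,
      binomial (A 0%N) (@cup R A 0 0) (cup_one A) &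
      binomial (R^o * A 1%N)%type (@RA1_mul R A) (RA1_one A)].

Record delta_set := DeltaSet {
  simplex :> nat -> Type;
  face : forall n, 'I_n.+2 -> simplex n.+1 -> simplex n;
  (* as i < j <= n + 2, the [inord]s do not truncate *)
  face_face : forall n (i j : 'I_n.+3) (s : simplex n.+2), (i < j)%N ->
    face (inord i : 'I_n.+2) (face j s) = face (inord j.-1 : 'I_n.+2) (face i s)
}.

Arguments face {d n}.

(* The face on the first i + 1 vertices: the last vertex is dropped j times. *)
Fixpoint front (X : delta_set) (i j : nat) : X (j + i)%N -> X i :=
  match j return X (j + i)%N -> X i with
  | 0 => fun s => s
  | j'.+1 => fun s => front (face (ord_max : 'I_(j' + i).+2) s)
  end.

(* The face on the last j + 1 vertices: the first vertex is dropped i times. *)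
Fixpoint back (X : delta_set) (i j : nat) : X (i + j)%N -> X j :=
  match i return X (i + j)%N -> X j with
  | 0 => fun s => s
  | i'.+1 => fun s => back (face (ord0 : 'I_(i' + j).+2) s)
  end.

Definition cochain (R : comNzRingType) (X : delta_set) (n : nat) : lmodType R :=
  (X n -> R^o : lmodType R).

Definition coch_dif (R : comNzRingType) (X : delta_set) (n : nat)
    (f : cochain R X n) : cochain R X n.+1 :=
  fun s => \sum_(i < n.+2) (-1) ^+ i * (f (face i s) : R).

Definition coch_cup (R : comNzRingType) (X : delta_set) (i j : nat)
    (u : cochain R X i) (v : cochain R X j) : cochain R X (i + j)%N :=
  fun s => (u (front (ecast k (X k) (addnC i j) s)) : R) * v (back s).

Definition coch_dga (R : comNzRingType) (X : delta_set) : dga_data R :=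
  @DgaData R (cochain R X) (@coch_cup R X) (fun=> 1) (@coch_dif R X).

(* Pointwise product, for u cup_1 v in degree 1 and v o w in degree 2. *)
Definition coch_mul (R : comNzRingType) (X : delta_set) (n : nat)
    (u v : cochain R X n) : cochain R X n :=
  fun s => (u s : R) * v s.

(* Steenrod's formula
     (w cup_1 c)(v_0 ... v_{p+q-1}) = \sum_(0 <= j < p) (-1)^((p-j)(q+1))
        w(v_0 ... v_j v_{j+q} ... v_{p+q-1}) c(v_j ... v_{j+q})
   in the case p = 2, q = 1. *)
Definition steenrod_cup1 (R : comNzRingType) (X : delta_set)
    (w : cochain R X 2%N) (c : cochain R X 1%N) : cochain R X 2%N :=
  fun s => (w s : R) * c (face ord_max s) + (w s : R) * c (face ord0 s).

Definition coch_cup_one (R : comNzRingType) (X : delta_set) : cup_one_data R :=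
  @CupOneData R (coch_dga R X) (@coch_mul R X 1%N)
    (fun w c => steenrod_cup1 (D2val w) c)
    (fun v w => @coch_mul R X 2%N (D2val v) (D2val w)).

(* The geometric realization is non-empty iff there is a simplex. *)
Definition delta_nonempty (X : delta_set) : Prop := exists n, inhabited (X n).

(* Main.v *)
(** The dga laws are checked on simplices bundled with their dimension, so that
    the degree casts disappear: the front and back faces are iterates of the
    operators dropping the last and the first vertex, which commute with the
    other faces by the simplicial identities. In the Leibniz rule the faces of
    [s] split into those seen by the front factor and those seen by the back
    factor; the two extra terms of the right-hand side cancel.

    The cup-one laws are polynomial identities in the values of the cochains on
    the faces of a single simplex. For the binomial axioms, A^0 is a ring of
    functions on vertices, and R (+) A^1 embeds into a ring of functions by
    (r, f) |-> r and (r, f) |-> r + f(e) for each edge e; so both axioms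
    reduce to R = Z and R = F_p. *)

From mathcomp Require Import zify ring.
Require Import Defs.

Set Implicit Arguments.
Unset Strict Implicit.
Unset Printing Implicit Defensive.

(** * Faces of simplices bundled with their dimension *)

Section TotalSimplices.

Variable X : delta_set.

Definition total_simplex := {n : nat & X n}.

(** A vertex is returned unchanged, so that [tag_totface] needs no side condition. The face
    identities fail under this convention on edges, whence the hypotheses [1 < tag S] below. *)
Definition totface (k : nat) (S : total_simplex) : total_simplex :=
  match S with
  | existT 0 _ => S
  | existT n.+1 x => existT X n (face (inord k : 'I_n.+2) x)
  end.

Definition drop_first (S : total_simplex) := totface 0 S.
Definition drop_last (S : total_simplex) := totface (tag S) S.

Lemma tag_totface k S : tag (totface k S) = (tag S).-1.
Proof. by case: S => -[|n] x. Qed.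

Lemma tag_iter_drop_last m S : tag (iter m drop_last S) = (tag S - m)%N.
Proof. by elim: m => [|m IH]; rewrite ?subn0 //= tag_totface IH subnS. Qed.

Lemma tag_iter_drop_first m S : tag (iter m drop_first S) = (tag S - m)%N.
Proof. by elim: m => [|m IH]; rewrite ?subn0 //= tag_totface IH subnS. Qed.

Lemma totface_totface i j S : (i < j <= tag S)%N -> (1 < tag S)%N ->
  totface i (totface j S) = totface j.-1 (totface i S).
Proof.
case: S => -[|[|n]] x //= /andP[ij jn] _; congr existT.
have iE : (inord i : 'I_n.+3) = i :> nat by rewrite inordK //; lia.
have jE : (inord j : 'I_n.+3) = j :> nat by rewrite inordK.
by have := face_face (i := inord i) (j := inord j) x; rewrite iE jE; apply.
Qed.

Lemma drop_last_totface k S : (k < tag S)%N -> (1 < tag S)%N ->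
  drop_last (totface k S) = totface k (drop_last S).
Proof.
by move=> kS S1; rewrite /drop_last tag_totface -totface_totface ?kS /=.
Qed.

Lemma drop_first_totface k S : (k < tag S)%N -> (1 < tag S)%N ->
  drop_first (totface k.+1 S) = totface k (drop_first S).
Proof. by move=> kS S1; rewrite /drop_first totface_totface. Qed.

Lemma iter_drop_last_totface m k S : (k + m < tag S)%N ->
  iter m drop_last (totface k S) = totface k (iter m drop_last S).
Proof.
elim: m => //= m IH kmS; rewrite IH; last by lia.
by rewrite drop_last_totface // tag_iter_drop_last; lia.
Qed.

(** Vertex [k] is among the last [m + 1] vertices, so deleting it and then [m] last vertices removes
    exactly these. *)
Lemma iter_drop_last_totface_ge m k S : (m < tag S)%N ->
  (tag S - m <= k <= tag S)%N ->
  iter m drop_last (totface k S) = iter m.+1 drop_last S.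
Proof.
elim: m S => [|m IH] S mS kS; first by rewrite (_ : k = tag S) //; lia.
have [->|kS'] := eqVneq k (tag S); first by rewrite [RHS]iterSr.
rewrite iterSr drop_last_totface; [|lia|lia].
by rewrite IH /drop_last ?tag_totface -?iterSr //; lia.
Qed.

(** Once the first [m] vertices are gone, vertex [m + k] has become vertex [k]. *)
Lemma iter_drop_first_totface m k S : (m < tag S)%N -> (m + k <= tag S)%N ->
  iter m drop_first (totface (m + k) S) = totface k (iter m drop_first S).
Proof.
elim: m S => // m IH S mS mkS; rewrite !iterSr addSn.
rewrite drop_first_totface; [|lia|lia].
by rewrite IH /drop_first ?tag_totface //; lia.
Qed.

Lemma iter_drop_first_totface_le m k S : (m < tag S)%N -> (k <= m)%N ->
  iter m drop_first (totface k S) = iter m.+1 drop_first S.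
Proof.
elim: m k S => [|m IH] [|k] S mS km //; first by rewrite [RHS]iterSr.
rewrite iterSr drop_first_totface; [|lia|lia].
by rewrite IH /drop_first ?tag_totface -?iterSr //; lia.
Qed.

Lemma iter_drop_lastC m i S : (i + m <= tag S)%N ->
  iter m drop_last (iter i drop_first S) =
  iter i drop_first (iter m drop_last S).
Proof.
elim: i => //= i IH imS; rewrite iter_drop_last_totface ?IH //; first lia.
by rewrite tag_iter_drop_first; lia.
Qed.

Lemma existT_ecast m n (e : m = n) (x : X m) :
  existT X n (ecast k (X k) e x) = existT X m x.
Proof. by case: n / e. Qed.

Lemma totface_face n (k : 'I_n.+2) (x : X n.+1) :
  existT X n (face k x) = totface k (existT X n.+1 x).
Proof. by rewrite /= inord_val. Qed.

Lemma existT_front i j (x : X (j + i)%N) :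
  existT X i (front x) = iter j drop_last (existT X (j + i)%N x).
Proof. by elim: j x => // j IH x; rewrite IH iterSr totface_face. Qed.

Lemma existT_back i j (x : X (i + j)%N) :
  existT X j (back x) = iter i drop_first (existT X (i + j)%N x).
Proof. by elim: i x => // i IH x; rewrite IH iterSr totface_face. Qed.

End TotalSimplices.

(** * Associativity, [d^2 = 0] and the Leibniz rule *)

Section Cochains.

Variables (R : comNzRingType) (X : delta_set).

(* Extension of an n-cochain by zero to simplices of all dimensions. *)
Definition ev n (f : cochain R X n) (S : total_simplex X) : R :=
  match eqVneq (tag S) n with
  | EqNotNeq e => f (ecast k (X k) e (tagged S))
  | NeqNotEq _ => 0
  end.

Lemma evE n (f : cochain R X n) (x : X n) : ev f (existT X n x) = f x.
Proof.
rewrite /ev; case: eqVneq => [e|/eqP] //=.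
by rewrite (eq_irrelevance e erefl).
Qed.

Lemma ev_degcast m n (e : m = n) (f : cochain R X m) :
  ev (degcast e f : cochain R X n) =1 ev f.
Proof. by case: n / e. Qed.

Lemma ev_inj n (f g : cochain R X n) :
  (forall S, tag S = n -> ev f S = ev g S) -> f = g.
Proof. by move=> fg; apply/funext => x; rewrite -!evE fg. Qed.

Lemma ev_add n (f g : cochain R X n) S : ev (f + g) S = ev f S + ev g S.
Proof. by rewrite /ev; case: eqVneq; rewrite ?addr0. Qed.

Lemma ev_scale n r (f : cochain R X n) S : ev (r *: f) S = r * ev f S.
Proof. by rewrite /ev; case: eqVneq; rewrite ?mulr0. Qed.

Lemma ev_cup i j (u : cochain R X i) (v : cochain R X j) S :
  tag S = (i + j)%N ->
  ev (coch_cup u v) S =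
    ev u (iter j (@drop_last X) S) * ev v (iter i (@drop_first X) S).
Proof.
case: S => n x /= e; case: _ / (esym e) x => x.
by rewrite evE /coch_cup -!evE existT_back existT_front existT_ecast.
Qed.

Lemma ev_dif n (f : cochain R X n) S : tag S = n.+1 ->
  ev (coch_dif f) S = \sum_(k < n.+2) (-1) ^+ k * ev f (totface k S).
Proof.
case: S => m x /= e; case: _ / (esym e) x => x.
by rewrite evE /coch_dif; apply: eq_bigr => k _; rewrite -[f _]evE totface_face.
Qed.

Lemma coch_cup_assoc i j k (a : cochain R X i) (b : cochain R X j)
    (c : cochain R X k) :
  degcast (addnA i j k) (coch_cup a (coch_cup b c)) =
  coch_cup (coch_cup a b) c.
Proof.
apply: ev_inj => S tS; rewrite ev_degcast !ev_cup ?tag_iter_drop_first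
  ?tag_iter_drop_last ?tS; try lia.
(* Only the middle factor [b] sees drops at both ends, in opposite orders on the two sides. *)
by rewrite mulrA iter_drop_lastC ?tS -?iterD; [rewrite [(j + i)%N]addnC|lia].
Qed.

(* The face identities turn the double sum into pairs of opposite terms; the
   induction adds the last row and the last column, which cancel. *)
Lemma alternating_double_sum0 (G : nat -> nat -> R) N :
  (forall i j, (i < j <= N)%N -> G i j = G j.-1 i) ->
  \sum_(j < N.+1) \sum_(i < N) (-1) ^+ j * ((-1) ^+ i * G i j) = 0.
Proof.
elim: N => [|N IH] GE; first by rewrite big_ord1 big_ord0.
rewrite big_ord_recr /=.
under eq_bigr do rewrite big_ord_recr /=.
rewrite big_split /= IH => [|i j ij]; last by apply: GE; lia.
rewrite add0r -big_split big1 //= => i _.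
by rewrite (GE i N.+1) /= ?exprS; [ring|have := ltn_ord i; lia].
Qed.

Lemma coch_dif_dif n (f : cochain R X n) : coch_dif (coch_dif f) = 0.
Proof.
apply: ev_inj => S tS; rewrite ev_dif //.
transitivity (\sum_(j < n.+3) \sum_(i < n.+2)
    (-1) ^+ j * ((-1) ^+ i * ev f (totface i (totface j S)))).
  by apply: eq_bigr => j _; rewrite ev_dif ?tag_totface ?tS // mulr_sumr.
rewrite (alternating_double_sum0 (G := fun i j =>
    ev f (totface i (totface j S)))); last first.
  by move=> i j ij; rewrite totface_totface ?tS.
by rewrite /ev; case: eqVneq.
Qed.

Lemma coch_dif_cup i j (a : cochain R X i) (b : cochain R X j) :
  coch_dif (coch_cup a b) =
    (coch_cup (coch_dif a) b : cochain R X (i + j).+1%N)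
    + (-1) ^+ i *: (degcast (addnS i j) (coch_cup a (coch_dif b))
        : cochain R X (i + j).+1%N).
Proof.
apply: ev_inj => S tS.
rewrite ev_add ev_scale ev_degcast ev_dif //.
rewrite (@ev_cup i.+1) // ev_cup; last by rewrite tS; lia.
rewrite !ev_dif ?tag_iter_drop_last ?tag_iter_drop_first ?tS; try lia.
(* [l * r] is the extra term: it has sign [(-1)^(i+1)] as the last face in [da], and [(-1)^i] as the
   first face in [db]. *)
pose l := ev a (iter j.+1 (@drop_last X) S).
pose r := ev b (iter i.+1 (@drop_first X) S).
(* Deleting one of the vertices [0..i] leaves the back factor equal to [r]; deleting a later one
   leaves the front factor equal to [l]. *)
have -> : (i + j).+2 = (i.+1 + j.+1)%N by lia.
rewrite big_split_ord [in RHS]big_ord_recr /=.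
rewrite [X in _ + _ * (_ * X)]big_ord_recl /=.
have -> : \sum_(k < i.+1) (-1) ^+ k * ev (coch_cup a b) (totface k S) =
    (\sum_(k < i.+1) (-1) ^+ k * ev a (totface k (iter j (@drop_last X) S))) * r.
  rewrite mulr_suml; apply: eq_bigr => k _; have ki := ltn_ord k.
  rewrite ev_cup ?tag_totface ?tS //.
  rewrite iter_drop_last_totface ?iter_drop_first_totface_le ?tS; try lia.
  by rewrite mulrA.
have -> : \sum_(k < j.+1) (-1) ^+ (i.+1 + k) *
      ev (coch_cup a b) (totface (i.+1 + k) S) =
    (-1) ^+ i * (l * \sum_(k < j.+1) (-1) ^+ k.+1 *
      ev b (totface k.+1 (iter i (@drop_first X) S))).
  rewrite !mulr_sumr; apply: eq_bigr => k _; have kj := ltn_ord k.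
  rewrite ev_cup ?tag_totface ?tS //.
  rewrite iter_drop_last_totface_ge ?tS; try lia.
  rewrite addSnnS iter_drop_first_totface ?tS; try lia.
  by rewrite exprD -/l; ring.
have -> : ev a (totface i.+1 (iter j (@drop_last X) S)) = l.
  rewrite /l /= /drop_last tag_iter_drop_last tS.
  by rewrite (_ : (i + j).+1 - j = i.+1)%N //; lia.
have -> : ev b (totface 0 (iter i (@drop_first X) S)) = r by [].
by rewrite exprS expr0 -/l -/r; ring.
Qed.

End Cochains.

(** * The cup-one structure on cochains *)

Lemma D2_ind (R : comNzRingType) (A : dga_data R) (P : A 2%N -> Prop) :
  P 0 -> (forall x y, P x -> P y -> P (x + y)) ->
  (forall r (a b : A 1%N), P (r *: (cup a b : A 2%N))) ->
  forall w, w \in D2_pred A -> P w.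
Proof.
move=> P0 PD PZ w /asboolP[n [r [a [b ->]]]].
by apply: big_ind => // i _; apply: PZ.
Qed.

Section CupOneDga.

Variables (R : comNzRingType) (X : delta_set).
(* These hold by conversion; they let [rewrite] see through the function
   module structure on cochains. *)
Lemma coch_zeroE n s : (0 : cochain R X n) s = 0 :> R.
Proof. by []. Qed.

Lemma coch_addE n (f g : cochain R X n) s : (f + g) s = f s + g s :> R.
Proof. by []. Qed.

Lemma coch_oppE n (f : cochain R X n) s : (- f) s = - f s :> R.
Proof. by []. Qed.

Lemma coch_scaleE n r (f : cochain R X n) s : (r *: f) s = r * f s :> R.
Proof. by []. Qed.

Lemma coch_mulnE n (f : cochain R X n) m s : (f *+ m) s = f s *+ m :> R.
Proof. by elim: m => // m IH; rewrite !mulrS coch_addE IH. Qed.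

Definition cochE := (coch_zeroE, coch_addE, coch_oppE, coch_scaleE).

Lemma coch_cup_bilinear i j : bilinear_map (@coch_cup R X i j).
Proof.
split=> [v k f g|u k f g]; apply/funext => s;
  rewrite !cochE /coch_cup !cochE; ring.
Qed.

Lemma coch_dif_linear n : linear (@coch_dif R X n).
Proof.
move=> k f g; apply/funext => s; rewrite !cochE /coch_dif mulr_sumr -big_split /=.
by apply: eq_bigr => i _; rewrite !cochE; ring.
Qed.

Lemma coch_mul_bilinear n : bilinear_map (@coch_mul R X n).
Proof.
split=> [v k f g|u k f g]; apply/funext => s;
  rewrite !cochE /coch_mul !cochE; ring.
Qed.

Lemma coch_is_dga : is_dga (coch_dga R X).
Proof.
split.
- exact: coch_cup_bilinear.
- exact: coch_cup_assoc.
- move=> i a; apply: ev_inj => S tS; rewrite (@ev_cup R X 0) //= .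
  (* After [i] drops only a vertex is left, and there the unit cochain is 1. *)
  case: (iter _ _ _) (tag_iter_drop_last i S) => m x /=.
  rewrite tS subnn => m0; case: _ / (esym m0) x => x.
  by rewrite evE /= mul1r.
- move=> i a; apply: ev_inj => S tS; rewrite ev_degcast ev_cup /= ?tS ?addn0 //.
  case: (iter _ _ _) (tag_iter_drop_first i S) => m x /=.
  rewrite tS subnn => m0; case: _ / (esym m0) x => x.
  by rewrite evE /= mulr1.
- exact: coch_dif_linear.
- exact: coch_dif_dif.
- exact: coch_dif_cup.
Qed.

(** Here and in the next three lemmas, passing through [ev] removes the cast along [addnC] in
    [coch_cup], leaving formulas that [ring] can use. *)
Lemma coch_cup00E (u v : cochain R X 0) x : coch_cup u v x = u x * v x.
Proof.
by rewrite -evE (@ev_cup R X 0 0) // !evE.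
Qed.

Lemma coch_cup01E (u : cochain R X 0) (v : cochain R X 1) x :
  coch_cup u v x = u (face ord_max x) * v x.
Proof.
by rewrite -evE (@ev_cup R X 0 1) // -[u _]evE -[v _]evE totface_face.
Qed.

Lemma coch_cup10E (u : cochain R X 1) (v : cochain R X 0) x :
  coch_cup u v x = u x * v (face ord0 x).
Proof.
by rewrite -evE (@ev_cup R X 1 0) // -[u _]evE -[v _]evE totface_face.
Qed.

Lemma coch_cup11E (u v : cochain R X 1) x :
  coch_cup u v x = u (face ord_max x) * v (face ord0 x).
Proof.
by rewrite -evE (@ev_cup R X 1 1) // -[u _]evE -[v _]evE !totface_face.
Qed.

Lemma coch_dif0E (f : cochain R X 0) x :
  coch_dif f x = f (face ord0 x) - f (face ord_max x).
Proof.
rewrite /coch_dif big_ord_recl big_ord1 /= expr0 mul1r expr1 mulN1r.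
by rewrite (_ : lift _ _ = ord_max) //; apply: val_inj.
Qed.

Lemma coch_dif1E (f : cochain R X 1) x :
  coch_dif f x = f (face ord0 x) - f (face (inord 1) x) + f (face ord_max x).
Proof.
rewrite /coch_dif !big_ord_recl big_ord0 /= expr0 mul1r expr1 mulN1r addr0.
rewrite sqrrN expr1n mul1r addrA; congr (_ - f (face _ x) + f (face _ x)).
  by apply: val_inj; rewrite /= inordK.
by apply: val_inj.
Qed.

(** By bilinearity it suffices to treat cup products, where the pointwise product of [a ∪ b] and
    [c ∪ e] is [(ac) ∪ (be)]. *)
Lemma coch_mul_in_D2 (v w : cochain R X 2) :
  v \in D2_pred (coch_dga R X) -> w \in D2_pred (coch_dga R X) ->
  coch_mul v w \in D2_pred (coch_dga R X).
Proof.
move=> vP wP; elim/D2_ind: vP => [|x y xP yP|r a b].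
- have -> : coch_mul 0 w = 0 by apply/funext => t; apply: mul0r.
  exact: rpred0.
- have -> : coch_mul (x + y) w = coch_mul x w + coch_mul y w.
    by apply/funext => t; apply: mulrDl.
  exact: rpredD.
elim/D2_ind: wP => [|x y xP yP|s c e].
- set u : cochain R X 2 := _ *: _; have -> : coch_mul u 0 = 0.
    by apply/funext => t; apply: mulr0.
  exact: rpred0.
- set u : cochain R X 2 := _ *: _ in xP yP *.
  have -> : coch_mul u (x + y) = coch_mul u x + coch_mul u y.
    by apply/funext => t; apply: mulrDr.
  exact: rpredD.
have -> : coch_mul (r *: (coch_cup a b : cochain R X 2))
    (s *: (coch_cup c e : cochain R X 2)) =
  (r * s) *: (coch_cup (coch_mul a c) (coch_mul b e) : cochain R X 2).
  by apply/funext => t; rewrite /coch_mul !cochE !coch_cup11E; ring.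
by apply: rpredZ; apply: (@cup_in_D2 R (coch_dga R X)).
Qed.

Lemma coch_RA1_algebra :
  is_comm_algebra (@RA1_mul R (coch_cup_one R X)) (RA1_one (coch_cup_one R X)).
Proof.
have ext (x y : R^o * cochain R X 1) :
    x.1 = y.1 -> (forall e, x.2 e = y.2 e) -> x = y.
  by case: x y => [r f] [s g] /= -> /funext ->.
split; first split.
- move=> x y z; apply: ext => [|e] /=; rewrite /coch_mul ?cochE /=; ring.
- move=> x y; apply: ext => [|e] /=; rewrite /coch_mul ?cochE /=; ring.
- move=> x; apply: ext => [|e] /=; rewrite /coch_mul ?cochE /=; ring.
- move=> x y z; apply: ext => [|e] /=; rewrite /coch_mul ?cochE /=; ring.
- move=> r x y; apply: ext => [|e]; first exact/esym/mulrA.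
  rewrite /= /coch_mul !cochE /= -[r *: x.1]/(r * x.1); ring.
Qed.

Lemma coch_is_cup_one_dga : is_cup_one_dga (coch_cup_one R X).
Proof.
split.
- exact: coch_is_dga.
- exact: coch_mul_bilinear.
- split=> [c k v w|v k c c']; apply/funext => s;
    rewrite /= !cochE /steenrod_cup1 /= !cochE; ring.
- by move=> v w; apply: coch_mul_in_D2; apply: D2valP.
- split=> [w k u v|u k v w]; apply/funext => s;
    rewrite /= !cochE /coch_mul /= !cochE; ring.
- exact: coch_RA1_algebra.
- move=> a b c; apply/funext => s.
  by rewrite /= !cochE /steenrod_cup1 !coch_cup11E /coch_mul; ring.
- move=> u v w z; apply/funext => s.
  by rewrite /= /coch_mul !coch_cup11E /coch_mul; ring.
- move=> a c; apply/funext => s.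
  by rewrite /= !cochE /coch_mul coch_cup10E coch_cup01E coch_dif0E; ring.
(* Write [a0, a1, a2] for the values of [a] on the faces of [s], [A = a0 + a2], and likewise for
   [b]. As [da = A - a1] and [db = B - b1], the terms [da B + db A - da db] collapse to
   [A B - a1 b1]; the two cup products cancel the cross terms of [A B]. *)
- move=> a b ha hb; apply/funext => s.
  rewrite /= !cochE /steenrod_cup1 /coch_mul /= !coch_cup11E !coch_dif1E.
  ring.
Qed.

End CupOneDga.

(** * The binomial axioms *)

Section Binomial.

Lemma falling_morph (V : zmodType) (S : comNzRingType) (mul : V -> V -> V)
    (one : V) (h : V -> S) a n :
  {morph h : x y / x - y} -> {morph h : x y / mul x y >-> x * y} -> h one = 1 ->
  h (falling mul one a n) = \prod_(i < n) (h a - i%:R).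
Proof.
move=> hB hM h1; rewrite /falling (big_morph h hM h1).
have h0 : h 0 = 0 by rewrite -(subrr 0) hB subrr.
have hN x : h (- x) = - h x by rewrite -sub0r hB h0 sub0r.
apply: eq_bigr => i _; rewrite hB; congr (_ - _).
elim: {i}(i : nat) => [|m IH]; first by rewrite !mulr0n.
by rewrite !mulrSr -[X in h (_ + X)]opprK hB hN IH h1 opprK.
Qed.

(** Pascal's rule multiplied by [(n+1)!]. *)
Lemma prod_falling_succ (S : comNzRingType) (c : S) n :
  \prod_(i < n.+1) (c + 1 - i%:R) =
  \prod_(i < n.+1) (c - i%:R) + (\prod_(i < n) (c - i%:R)) *+ n.+1.
Proof.
have E : \prod_(i < n) (c + 1 - (lift ord0 i)%:R) = \prod_(i < n) (c - i%:R).
  by apply: eq_bigr => i _; rewrite lift0 -natr1; ring.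
rewrite big_ord_recl E big_ord_recr /= subr0.
by rewrite -[_ *+ n.+1]mulr_natr -natr1; ring.
Qed.

(** Induction on [n], then on [a] in both directions from 0, where the factor [i = 0] vanishes. By
    Pascal's rule, moving [a] by one changes the product by [n + 1] times a multiple of [n!]. *)
Lemma fact_dvd_falling (a : int) n :
  exists b : int, b *+ n`! = \prod_(i < n) (a - i%:R).
Proof.
elim: n a => [|n IH] a; first by exists 1; rewrite big_ord0.
elim/int_ind: a => [|m [b bE]|m [b bE]].
- by exists 0; rewrite mul0rn big_ord_recl subr0 mul0r.
- have [c cE] := IH m%:Z; exists (b + c).
  rewrite (_ : m.+1%:Z = m%:Z + 1); last by lia.
  by rewrite prod_falling_succ -bE -cE factS mulrnDl -mulrnA [(_ * n.+1)%N]mulnC.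
- have [c cE] := IH (- m.+1%:Z); exists (b - c).
  have := prod_falling_succ (- m.+1%:Z) n.
  rewrite (_ : _ + 1 = - m%:Z); last by lia.
  rewrite -bE -cE -mulrnA [(_ * n.+1)%N]mulnC -factS mulrnBl => ->.
  by rewrite addrK.
Qed.

(** The representative of [x] below [p] is one of the indices [i], so its factor is zero. *)
Lemma Fp_falling0 p (x : 'F_p) : prime p -> \prod_(i < p) (x - i%:R) = 0.
Proof.
move=> p_pr; have xp : (x < p)%N by rewrite -[p in (_ < p)%N]Fp_cast //.
by rewrite (bigD1 (Ordinal xp)) //= natr_Zp subrr mul0r.
Qed.

Variable X : delta_set.

Definition RA1_ev (R : comNzRingType) (e : X 1) (x : R^o * cochain R X 1) : R :=
  x.1 + x.2 e.

Section Falling.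

Variable R : comNzRingType.
Lemma coch0_algebra : is_comm_algebra (@coch_cup R X 0 0) (cup_one (coch_dga R X)).
Proof.
split; first split.
- by move=> u v w; apply/funext => s; rewrite !coch_cup00E mulrA.
- by move=> u v; apply/funext => s; rewrite !coch_cup00E mulrC.
- by move=> u; apply/funext => s; rewrite !coch_cup00E mul1r.
- by move=> u v w; apply/funext => s; rewrite cochE !coch_cup00E cochE mulrDl.
- by move=> r u v; apply/funext => s; rewrite cochE !coch_cup00E cochE mulrA.
Qed.

Lemma coch0_falling (a : cochain R X 0) n x :
  (falling (@coch_cup R X 0 0) (cup_one (coch_dga R X)) a n : cochain R X 0) x =
  \prod_(i < n) (a x - i%:R).
Proof.
by rewrite (@falling_morph _ R _ _ (fun f : cochain R X 0 => f x)) // => u v;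
  rewrite coch_cup00E.
Qed.

Local Notation RA1_falling :=
  (falling (@RA1_mul R (coch_cup_one R X)) (RA1_one (coch_cup_one R X))).

Lemma RA1_falling_fst a n : (RA1_falling a n).1 = \prod_(i < n) (a.1 - i%:R) :> R.
Proof. by rewrite (@falling_morph _ R _ _ fst). Qed.

Lemma RA1_falling_ev a n e :
  RA1_ev e (RA1_falling a n) = \prod_(i < n) (RA1_ev e a - i%:R).
Proof.
rewrite (@falling_morph _ R _ _ (RA1_ev e)) // => [u v|u v|];
  rewrite /RA1_ev /= ?cochE /coch_mul /=; ring.
Qed.

(** The first components are compared separately because [X] may have no edges. *)
Lemma RA1_ev_inj (x y : R^o * cochain R X 1) :
  x.1 = y.1 -> (forall e, RA1_ev e x = RA1_ev e y) -> x = y.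
Proof.
case: x y => [r f] [s g] /= -> fg; congr pair; apply/funext => e.
by have := fg e; rewrite /RA1_ev /= => /addrI.
Qed.

End Falling.

Lemma coch0_Z_binomial :
  Z_binomial (@coch_cup int X 0 0) (cup_one (coch_dga int X)).
Proof.
split; first by case: (coch0_algebra int).
- move=> n v n0 vn; apply/funext => x.
  have /eqP := congr1 (fun f : cochain int X 0 => f x) vn.
  by rewrite coch_mulnE Num.Theory.mulrn_eq0 eqn0Ngt n0 /= => /eqP.
- move=> a n _; have [b bE] := choice (fun x => fact_dvd_falling (a x) n).
  by exists b; apply/funext => x; rewrite coch_mulnE coch0_falling bE.
Qed.

Lemma RA1_Z_binomial :
  Z_binomial (@RA1_mul int (coch_cup_one int X)) (RA1_one (coch_cup_one int X)).
Proof.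
have pairMn (v : int^o * cochain int X 1) n : v *+ n = (v.1 *+ n, v.2 *+ n).
  by elim: n => [|n IH]; rewrite ?mulr0n // !mulrS IH.
split; first by case: (coch_RA1_algebra int X).
- move=> n v n0; rewrite pairMn => -[v1 v2].
  case: v v1 v2 => [r f] /= /eqP; rewrite Num.Theory.mulrn_eq0 eqn0Ngt n0 /= => /eqP -> fn.
  congr pair; apply/funext => x.
  have /eqP := congr1 (fun f : cochain int X 1 => f x) fn.
  by rewrite coch_mulnE Num.Theory.mulrn_eq0 eqn0Ngt n0 /= => /eqP.
- move=> a n _; have [r rE] := fact_dvd_falling a.1 n.
  have [b bE] := choice (fun e => fact_dvd_falling (RA1_ev e a) n).
  (* Subtracting [r] makes the value of [RA1_ev e] on this pair equal to [b e], the binomial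
     coefficient of [RA1_ev e a]. *)
  exists (r, (fun e => b e - r) : cochain int X 1); rewrite pairMn.
  apply: RA1_ev_inj => [|e]; first by rewrite RA1_falling_fst -rE.
  by rewrite RA1_falling_ev -bE /RA1_ev /= coch_mulnE -mulrnDl addrC subrK.
Qed.

Lemma coch0_Fp_binomial p : prime p ->
  Fp_binomial (@coch_cup 'F_p X 0 0) (cup_one (coch_dga 'F_p X)).
Proof.
move=> p_pr; split=> [|a]; first exact: coch0_algebra.
by apply/funext => x; rewrite coch0_falling Fp_falling0.
Qed.

Lemma RA1_Fp_binomial p : prime p ->
  Fp_binomial (@RA1_mul 'F_p (coch_cup_one 'F_p X))
    (RA1_one (coch_cup_one 'F_p X)).
Proof.
move=> p_pr; split=> [|a]; first exact: coch_RA1_algebra.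
apply: RA1_ev_inj => [|e]; first by rewrite RA1_falling_fst Fp_falling0.
by rewrite RA1_falling_ev Fp_falling0 // /RA1_ev addr0.
Qed.

End Binomial.

Theorem theorem5p12 (X : delta_set) (hX : delta_nonempty X) :
  is_binomial_cup_one_dga Z_binomial (coch_cup_one int X) /\
  (forall p : nat, prime p ->
     is_binomial_cup_one_dga (@Fp_binomial p) (coch_cup_one 'F_p X)).
Proof.
split=> [|p p_pr]; split; try exact: coch_is_cup_one_dga.
- exact: coch0_Z_binomial.
- exact: RA1_Z_binomial.
- exact: coch0_Fp_binomial.
- exact: RA1_Fp_binomial.
Qed.
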